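(* Let $\mathcal{C}$ be a Conway category and let $(\mathbf{Q},q)$ be an initialized finite automaton which is initially connected. If $\mathcal{C}$ satisfies the identity $\Gamma(\mathbf{Q},q)$, then $\mathcal{C}$ satisfies the group identity $\Gamma(G)$ for every finite simple group $G$ that divides the monoid $M(\mathbf{Q})$.
   Context: Cartesian categories have chosen finite products (terminal object $T$, projections $\pi_i$, tupling $\langle\cdot\rangle$, $!_A:A\to T$, $f\times g$), strictly associative; composition is written $g\circ f$; $\Delta_{A^n}=\langle 1_A,\ldots,1_A\rangle:A\to A^n$. A dagger operation maps $f:A\times C\to A$ to $f^\dagger:C\to A$. A Conway category is a cartesian category with dagger satisfying: $(f\circ(1_A\times g))^\dagger=f^\dagger\circ g$ ($f:A\times B\to A$, $g:C\to B$); $f^{\dagger\dagger}=(f\circ(\Delta_{A^2}\times 1_C))^\dagger$ ($f:A\times A\times C\to A$); $(f\circ\langle g,\pi_2^{A\times C}\rangle)^\dagger=f\circ\langle (g\circ\langle f,\pi_2^{B\times C}\rangle)^\dagger,1_C\rangle$ ($f:B\times C\to A$, $g:A\times C\to B$). A finite automaton $\mathbf{Q}=(Q,Z,\cdot)$ has finite nonempty state set $Q$, finite nonempty input alphabet $Z$ and action $Q\times Z\to Q$, extended to words; $M(\mathbf{Q})$ is the monoid of functions $Q\to Q$, $q\mapsto qu$, induced by words $u\in Z^*$. Write $Q=\{q_1,\ldots,q_n\}$, identified with $\{1,\ldots,n\}$, and $Z=\{a_1,\ldots,a_m\}$. For an object $A$ and $i\in[n]$ let $\rho_i^{\mathbf{Q},A}=\langle\pi^{A^n}_{ia_1},\ldots,\pi^{A^n}_{ia_m}\rangle:A^n\to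 A^m$ ($ia_j$ is the index of $q_i\cdot a_j$). For $f:A^m\times C\to A$ let $f^{\mathbf{Q},A}:A^n\times C\to A^n$ have components $\pi_i^{A^n}\circ f^{\mathbf{Q},A}=f\circ(\rho_i^{\mathbf{Q},A}\times 1_C)$. An initialized automaton $(\mathbf{Q},q_i)$ has a distinguished state; the identity $\Gamma(\mathbf{Q},q_i)$ holds in $\mathcal{C}$ if $\pi_i^{A^n}\circ(f^{\mathbf{Q},A})^\dagger=(f\circ(\Delta_{A^m}\times 1_C))^\dagger$ for all objects $A,C$ and all $f:A^m\times C\to A$. $(\mathbf{Q},q)$ is initially connected if every state equals $qu$ for some word $u$. For a finite group $G$, $\Gamma(G)$ is the identity $\Gamma(\mathbf{Q}_G)$ for the automaton $\mathbf{Q}_G=(G,G,\cdot)$ with action by multiplication, where $\Gamma(\mathbf{P})$ for an automaton $\mathbf{P}$ with $n$ states and $m$ letters means $(f^{\mathbf{P},A})^\dagger=\Delta_{A^n}\circ(f\circ(\Delta_{A^m}\times 1_C))^\dagger$ for all $f:A^m\times C\to A$. A group in a finite monoid $M$ is a subsemigroup which is a group; a finite group divides $M$ if it is a homomorphic image of a group in $M$. A finite group is simple if it is nontrivial and has no normal subgroups other than itself and the trivial one. *)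

(* Defs.v *)
From mathcomp Require Import all_boot all_order all_fingroup all_solvable.
Set Implicit Arguments. Unset Strict Implicit. Unset Printing Implicit Defensive.

Record cartCat := CartCat {
  ob : Type;
  hom : ob -> ob -> Type;
  comp : forall A B C, hom B C -> hom A B -> hom A C;
  idm : forall A, hom A A;
  compA : forall A B C D (h : hom C D) (g : hom B C) (f : hom A B),
      comp h (comp g f) = comp (comp h g) f;
  comp1m : forall A B (f : hom A B), comp (idm B) f = f;
  compm1 : forall A B (f : hom A B), comp f (idm A) = f;
  term : ob;
  bang : forall A, hom A term;
  bang_uniq : forall A (f : hom A term), f = bang A;
  prod : ob -> ob -> ob;
  pi1 : forall A B, hom (prod A B) A;
  pi2 : forall A B, hom (prod A B) B;
  pair : forall C A B, hom C A -> hom C B -> hom C (prod A B);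
  pi1_pair : forall C A B (f : hom C A) (g : hom C B), comp (pi1 A B) (pair f g) = f;
  pi2_pair : forall C A B (f : hom C A) (g : hom C B), comp (pi2 A B) (pair f g) = g;
  pair_uniq : forall C A B (h : hom C (prod A B)),
      h = pair (comp (pi1 A B) h) (comp (pi2 A B) h)
}.

Arguments hom : clear implicits.
Arguments comp {c A B C} _ _.
Arguments idm {c} A.
Arguments term {c}.
Arguments bang {c} A.
Arguments prod {c} _ _.
Arguments pi1 {c} A B.
Arguments pi2 {c} A B.
Arguments pair {c C A B} _ _.

Definition prodm (K : cartCat) (A B A' B' : ob K) (f : hom K A A') (g : hom K B B')
  : hom K (prod A B) (prod A' B') :=
  pair (comp f (pi1 A B)) (comp g (pi2 A B)).

Definition assocr (K : cartCat) (A B C : ob K)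
  : hom K (prod (prod A B) C) (prod A (prod B C)) :=
  pair (comp (pi1 A B) (pi1 (prod A B) C))
       (pair (comp (pi2 A B) (pi1 (prod A B) C)) (pi2 (prod A B) C)).

Fixpoint powS (K : cartCat) (A : ob K) (k : nat) : ob K :=
  match k with 0 => A | k'.+1 => prod A (@powS K A k') end.

Definition pow (K : cartCat) (A : ob K) (n : nat) : ob K :=
  match n with 0 => term | k.+1 => powS A k end.

Fixpoint prjS (K : cartCat) (A : ob K) (k : nat) : 'I_k.+1 -> hom K (powS A k) A :=
  match k return 'I_k.+1 -> hom K (powS A k) A with
  | 0 => fun _ => idm A
  | k'.+1 => fun i => match unlift ord0 i with
                     | None => pi1 A (powS A k')
                     | Some j => comp (@prjS K A k' j) (pi2 A (powS A k'))
                     end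
  end.

Definition prj (K : cartCat) (A : ob K) (n : nat) : 'I_n -> hom K (pow A n) A :=
  match n return 'I_n -> hom K (pow A n) A with
  | 0 => fun i => False_rect _ (@Logic.eq_ind bool true (fun b => if b then True else False) I false
                                  (etrans (esym (ltn_ord i)) (ltn0 i)))
  | k.+1 => fun i => @prjS K A k i
  end.

Fixpoint tupS (K : cartCat) (X A : ob K) (k : nat)
  : ('I_k.+1 -> hom K X A) -> hom K X (powS A k) :=
  match k return ('I_k.+1 -> hom K X A) -> hom K X (powS A k) with
  | 0 => fun fs => fs ord0
  | k'.+1 => fun fs => pair (fs ord0) (@tupS K X A k' (fun j => fs (lift ord0 j)))
  end.

Definition tup (K : cartCat) (X A : ob K) (n : nat)
  : ('I_n -> hom K X A) -> hom K X (pow A n) :=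
  match n return ('I_n -> hom K X A) -> hom K X (pow A n) with
  | 0 => fun _ => bang X
  | k.+1 => fun fs => tupS fs
  end.

Definition diag (K : cartCat) (A : ob K) (n : nat) : hom K A (pow A n) :=
  tup (fun _ : 'I_n => idm A).

Definition dagger_op (K : cartCat) :=
  forall A C : ob K, hom K (prod A C) A -> hom K C A.

Definition conway_axioms (K : cartCat) (dag : dagger_op K) : Prop :=
  (forall (A B C : ob K) (f : hom K (prod A B) A) (g : hom K C B),
      dag A C (comp f (prodm (idm A) g)) = comp (dag A B f) g) /\
  (* double dagger identity; A x A x C is read as A x (A x C) *)
  (forall (A C : ob K) (f : hom K (prod A (prod A C)) A),
      dag A C (dag A (prod A C) f)
      = dag A C (comp f (comp (assocr A A C) (prodm (diag A 2) (idm C))))) /\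
  (forall (A B C : ob K) (f : hom K (prod B C) A) (g : hom K (prod A C) B),
      dag A C (comp f (pair g (pi2 A C)))
      = comp f (pair (dag B C (comp g (pair f (pi2 B C)))) (idm C))).

Record conwayCat := ConwayCat {
  ccat :> cartCat;
  dag : dagger_op ccat;
  dag_ax : conway_axioms dag
}.
Arguments dag {c} A C _.

Record automaton := Automaton {
  state : finType;
  input : finType;
  act : state -> input -> state
}.

Definition act_word (Q : automaton) (q : state Q) (w : seq (input Q)) : state Q :=
  foldl (@act Q) q w.

Definition initially_connected (Q : automaton) (q : state Q) : Prop :=
  forall q' : state Q, exists w : seq (input Q), q' = act_word q w.

(* States and letters are identified with 'I_n and 'I_m via enum_rank / enum_val. *)
Definition rho (K : cartCat) (Q : automaton) (A : ob K) (q : state Q)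
  : hom K (pow A #|state Q|) (pow A #|input Q|) :=
  tup (fun j : 'I_#|input Q| => prj A (enum_rank (act q (enum_val j)))).

Definition fQ (K : cartCat) (Q : automaton) (A C : ob K)
  (f : hom K (prod (pow A #|input Q|) C) A)
  : hom K (prod (pow A #|state Q|) C) (pow A #|state Q|) :=
  tup (fun i : 'I_#|state Q| => comp f (prodm (@rho K Q A (enum_val i)) (idm C))).

Definition Gamma_init (K : conwayCat) (Q : automaton) (q : state Q) : Prop :=
  forall (A C : ob K) (f : hom K (prod (pow A #|input Q|) C) A),
    comp (prj A (enum_rank q)) (dag _ _ (fQ f))
    = dag A C (comp f (prodm (diag A #|input Q|) (idm C))).

Definition Gamma (K : conwayCat) (P : automaton) : Prop :=
  forall (A C : ob K) (f : hom K (prod (pow A #|input P|) C) A),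
    dag _ _ (fQ f)
    = comp (diag A #|state P|) (dag A C (comp f (prodm (diag A #|input P|) (idm C)))).

Definition group_automaton (gT : finGroupType) : automaton :=
  @Automaton gT gT (fun g h => (g * h)%g).

Definition in_trans_monoid (Q : automaton) (h : {ffun state Q -> state Q}) : Prop :=
  exists w : seq (input Q), forall q, h q = act_word q w.

(* product in M(Q): the function of u followed by the function of v,
   so that (fun of u) * (fun of v) = fun of uv *)
Definition mmul (Q : automaton) (h1 h2 : {ffun state Q -> state Q})
  : {ffun state Q -> state Q} := [ffun q => h2 (h1 q)].

Definition group_in_monoid (Q : automaton) (H : {set {ffun state Q -> state Q}}) : Prop :=
  (forall h, h \in H -> in_trans_monoid h) /\
  (forall h1 h2, h1 \in H -> h2 \in H -> mmul h1 h2 \in H) /\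
  exists2 e, e \in H &
    (forall h, h \in H -> mmul e h = h /\ mmul h e = h) /\
    (forall h, h \in H -> exists2 h', h' \in H & mmul h h' = e /\ mmul h' h = e).

Definition divides_monoid (gT : finGroupType) (Q : automaton) : Prop :=
  exists H : {set {ffun state Q -> state Q}},
    group_in_monoid H /\
    exists phi : {ffun state Q -> state Q} -> gT,
      (forall h1 h2, h1 \in H -> h2 \in H -> phi (mmul h1 h2) = (phi h1 * phi h2)%g) /\
      phi @: H = [set: gT].

(* Main.v *)
(** The identity at an automaton says that a system of fixed point equations
    indexed by its states has the diagonal solution. Applied to powers [A^S] of
    an object it also solves systems in which extra unknowns, indexed by [S], run
    in cascade with the automaton. Extra unknowns that name the states [i b]
    move the identity from [q] to every reachable state and replace letters by
    nonempty words, so a group [H] in the transition monoid may serve as input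
    alphabet. The regular automaton of [H] embeds into a power of the resulting
    automaton by [h |-> (h p)_p], which gives the identity at [H]. Finally [H]
    embeds into a cascade of [H] under its quotient [G], so the [H]-system has
    both the diagonal solution and the solution of the [G]-system. *)

From mathcomp Require Import all_boot all_order all_fingroup all_solvable.
Require Import Defs.
Set Implicit Arguments. Unset Strict Implicit. Unset Printing Implicit Defensive.

Declare Scope cart_scope.
Local Open Scope cart_scope.
Local Notation "g ∘ f" := (comp g f) (at level 40, left associativity) : cart_scope.
Local Notation "⟨ f , g ⟩" := (pair f g) (format "⟨ f ,  g ⟩") : cart_scope.

(** * Finite products indexed by finite types *)

Section Cartesian.
Variable K : cartCat.
Implicit Types A B C X Y W : ob K.

Lemma pair_ext X A B (f g : hom K X (prod A B)) :
  pi1 A B ∘ f = pi1 A B ∘ g -> pi2 A B ∘ f = pi2 A B ∘ g -> f = g.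
Proof. by move=> e1 e2; rewrite (pair_uniq f) (pair_uniq g) e1 e2. Qed.

Lemma pair_comp W X A B (f : hom K X A) (g : hom K X B) (h : hom K W X) :
  ⟨f, g⟩ ∘ h = ⟨f ∘ h, g ∘ h⟩.
Proof. by apply: pair_ext; rewrite compA !(pi1_pair, pi2_pair). Qed.

Lemma pair_pi A B : ⟨pi1 A B, pi2 A B⟩ = idm (prod A B).
Proof. by apply: pair_ext; rewrite !(pi1_pair, pi2_pair) compm1. Qed.

Definition cartE :=
  (=^~ compA, pair_comp, pi1_pair, pi2_pair, comp1m, compm1, pair_pi).

Lemma prjS_tupS X A k (fs : 'I_k.+1 -> hom K X A) i : prjS A i ∘ tupS fs = fs i.
Proof.
elim: k fs i => [|k IH] fs i /=; first by rewrite comp1m ord1.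
by case: unliftP => [j|] ->; rewrite !cartE ?IH.
Qed.

Lemma prj_tup X A n (fs : 'I_n -> hom K X A) i : prj A i ∘ tup fs = fs i.
Proof. by case: n fs i => [|n] fs i; [case: i | exact: prjS_tupS]. Qed.

Lemma prjS_ext X A k (f g : hom K X (powS A k)) :
  (forall i, prjS A i ∘ f = prjS A i ∘ g) -> f = g.
Proof.
elim: k f g => [|k IH] f g e; first by have := e ord0; rewrite /= !comp1m.
apply: pair_ext; first by have := e ord0; rewrite /= unlift_none.
by apply: IH => i; have := e (lift ord0 i); rewrite /= liftK -!compA.
Qed.

Lemma prj_ext X A n (f g : hom K X (pow A n)) :
  (forall i, prj A i ∘ f = prj A i ∘ g) -> f = g.
Proof.
by case: n f g => [|n] f g e; [rewrite (bang_uniq f) (bang_uniq g) | exact: prjS_ext].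
Qed.

(** Indexing by [I] hides the ranks, while [fpow A (state Q)] stays convertible to the power in
    [Gamma_init]. *)
Definition fpow A (I : finType) : ob K := pow A #|I|.

Definition fprj A (I : finType) (i : I) : hom K (fpow A I) A := prj A (enum_rank i).

Definition ftup X A (I : finType) (F : I -> hom K X A) : hom K X (fpow A I) :=
  tup (fun j : 'I_#|I| => F (enum_val j)).

Lemma fprj_ftup X A (I : finType) (F : I -> hom K X A) i : fprj A i ∘ ftup F = F i.
Proof. by rewrite /fprj /ftup prj_tup enum_rankK. Qed.

Lemma fprj_ftup_comp W X A (I : finType) (F : I -> hom K X A) i (h : hom K W X) :
  fprj A i ∘ (ftup F ∘ h) = F i ∘ h.
Proof. by rewrite compA fprj_ftup. Qed.

Lemma fprj_ext X A (I : finType) (f g : hom K X (fpow A I)) :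
  (forall i, fprj A i ∘ f = fprj A i ∘ g) -> f = g.
Proof.
by move=> e; apply: prj_ext => j; have := e (enum_val j); rewrite /fprj enum_valK.
Qed.

Lemma eq_ftup X A (I : finType) (F G : I -> hom K X A) : F =1 G -> ftup F = ftup G.
Proof. by move=> e; apply: fprj_ext => i; rewrite !fprj_ftup. Qed.

Lemma ftup_comp W X A (I : finType) (F : I -> hom K X A) (h : hom K W X) :
  ftup F ∘ h = ftup (fun i => F i ∘ h).
Proof. by apply: fprj_ext => i; rewrite fprj_ftup_comp fprj_ftup. Qed.

End Cartesian.

(** * Consequences of the Conway identities *)

Section Dagger.
Variable K : conwayCat.
Implicit Types A B C X Y W : ob K.

Lemma dag_param A B C (f : hom K (prod A B) A) (g : hom K C B) :
  dag A C (f ∘ ⟨pi1 A C, g ∘ pi2 A C⟩) = dag A B f ∘ g.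
Proof. by have [<- _] := dag_ax K; rewrite /prodm comp1m. Qed.

Lemma dag_dag A C (f : hom K (prod A (prod A C)) A) :
  dag A C (dag A (prod A C) f) = dag A C (f ∘ ⟨pi1 A C, idm (prod A C)⟩).
Proof.
have [_ [-> _]] := dag_ax K; congr (dag _ _ (_ ∘ _)).
by rewrite /assocr /prodm /diag /= !cartE.
Qed.

Lemma dag_comp A B C (f : hom K (prod B C) A) (g : hom K (prod A C) B) :
  dag A C (f ∘ ⟨g, pi2 A C⟩) = f ∘ ⟨dag B C (g ∘ ⟨f, pi2 B C⟩), idm C⟩.
Proof. by have [_ [_ ->]] := dag_ax K. Qed.

Lemma dag_fix A C (f : hom K (prod A C) A) : f ∘ ⟨dag A C f, idm C⟩ = dag A C f.
Proof. by have := dag_comp f (pi1 A C); rewrite !cartE. Qed.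

(** The double dagger identity separates the occurrence of [y] under [r] from the other one; the
    composition identity then solves for [x = r y]. *)
Lemma dag_split X Y C (r : hom K Y X) (k : hom K (prod Y (prod X C)) Y) :
  dag Y C (k ∘ ⟨pi1 Y C, ⟨r ∘ pi1 Y C, pi2 Y C⟩⟩)
  = dag Y _ k ∘ ⟨dag X C (r ∘ dag Y _ k), idm C⟩.
Proof.
have -> : k ∘ ⟨pi1 Y C, ⟨r ∘ pi1 Y C, pi2 Y C⟩⟩
    = (k ∘ ⟨pi1 Y (prod Y C), ⟨r ∘ pi1 Y C, pi2 Y C⟩ ∘ pi2 Y (prod Y C)⟩)
      ∘ ⟨pi1 Y C, idm (prod Y C)⟩ by rewrite !cartE.
by rewrite -dag_dag dag_param dag_comp !cartE.
Qed.

(** Here [m] overwrites the [X]-part of a point of [Y]. Solving [y = F (m (x, y), c)] with [x] as a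
    parameter gives a [y] with [X]-part [G (x, c)]; [dag_split] then sets [x = r y]. *)
Lemma dag_proj X Y C (r : hom K Y X) (m : hom K (prod X Y) Y)
    (F : hom K (prod Y C) Y) (G : hom K (prod X C) X) :
  m ∘ ⟨r, idm Y⟩ = idm Y -> r ∘ m = pi1 X Y ->
  r ∘ F = G ∘ ⟨r ∘ pi1 Y C, pi2 Y C⟩ -> r ∘ dag Y C F = dag X C G.
Proof.
move=> mr rm rF.
pose k : hom K (prod Y (prod X C)) Y :=
  F ∘ ⟨m ∘ ⟨pi1 X C ∘ pi2 _ _, pi1 _ _⟩, pi2 X C ∘ pi2 _ _⟩.
have eF : F = k ∘ ⟨pi1 Y C, ⟨r ∘ pi1 Y C, pi2 Y C⟩⟩.
  have mr' : m ∘ ⟨r ∘ pi1 Y C, pi1 Y C⟩ = pi1 Y C.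
    by rewrite -[RHS]comp1m -mr !cartE.
  by rewrite /k !cartE mr' !cartE.
have rk : r ∘ dag Y _ k = G.
  by rewrite -dag_fix /k !cartE compA rF !cartE compA rm !cartE.
by rewrite {1}eF dag_split compA rk dag_fix.
Qed.

(** With [y = u (x, x')] the system reads [x = f (u (x, x'), c)], [x' = x]. Solving first for [x]
    with parameter [x'] yields a double dagger, which merges the two copies. *)
Lemma dag_elim X Y C (u : hom K (prod X X) Y) (r : hom K Y X)
    (f : hom K (prod Y C) X) :
  r ∘ u = pi1 X X ->
  let x := dag X C (f ∘ ⟨u ∘ ⟨pi1 X C, pi1 X C⟩, pi2 X C⟩) in
  dag Y C (u ∘ ⟨f, r ∘ pi1 Y C⟩) = u ∘ ⟨x, x⟩.
Proof.
move=> ru x.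
pose v : hom K (prod X (prod X C)) Y := u ∘ ⟨pi1 _ _, pi1 X C ∘ pi2 _ _⟩.
pose g : hom K (prod Y (prod X C)) X := f ∘ ⟨pi1 _ _, pi2 X C ∘ pi2 _ _⟩.
have -> : u ∘ ⟨f, r ∘ pi1 Y C⟩
    = (v ∘ ⟨g, pi2 _ _⟩) ∘ ⟨pi1 Y C, ⟨r ∘ pi1 Y C, pi2 Y C⟩⟩.
  by rewrite /v /g !cartE.
rewrite dag_split dag_comp.
set psi := dag X (prod X C) _.
have -> : r ∘ (v ∘ ⟨psi, idm (prod X C)⟩) = psi.
  by rewrite /v !cartE compA ru !cartE.
have ex : dag X C psi = x.
  by rewrite /psi dag_dag /g /v /x !cartE.
by have := dag_fix psi; rewrite ex /v !cartE => ->.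
Qed.

End Dagger.

(** * Cascades, subautomata and products *)

Section Automata.
Variable K : conwayCat.
Implicit Types (A C : ob K) (Q : automaton).

Lemma fQE Q A C (f : hom K (prod (fpow A (input Q)) C) A) :
  fQ f = ftup (fun q : state Q =>
    f ∘ ⟨ftup (fun a => fprj A (act q a) ∘ pi1 (fpow A (state Q)) C), pi2 _ C⟩).
Proof.
apply: (@eq_ftup K _ A (state Q) (fun q => f ∘ prodm (rho A q) (idm C))) => q.
rewrite /prodm comp1m; congr (_ ∘ ⟨_, _⟩).
exact: (@ftup_comp K _ _ A (input Q) (fun a => fprj A (act q a))).
Qed.

Lemma diag_compE (I : finType) A C (f : hom K (prod (fpow A I) C) A) :
  f ∘ prodm (diag A #|I|) (idm C) = f ∘ ⟨ftup (fun _ : I => pi1 A C), pi2 A C⟩.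
Proof.
rewrite /prodm comp1m; congr (_ ∘ ⟨_, _⟩).
by apply: fprj_ext => i; rewrite compA /fprj /diag !prj_tup comp1m.
Qed.

(* [T] embeds into a cascade of [I] under [S]: the family of unknowns of the
   [T]-system is part of a single [I]-system over the object [A^S]. *)
Lemma cascade (T I S : automaton) (p1 : state T -> state I) (p2 : state T -> state S)
    (lS : input T -> input S) (lI : state S -> input T -> input I) :
  (forall t t', p1 t = p1 t' -> p2 t = p2 t' -> t = t') ->
  (forall t a, p1 (act t a) = act (p1 t) (lI (p2 t) a)) ->
  (forall t a, p2 (act t a) = act (p2 t) (lS a)) ->
  forall t, Gamma_init K (p1 t) ->
  forall A C (f : hom K (prod (fpow A (input T)) C) A),
  fprj A t ∘ dag _ _ (fQ f)
  = fprj A (p2 t) ∘ dag _ _ (fQ (Q := S)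
      (f ∘ ⟨ftup (fun a => fprj A (lS a) ∘ pi1 (fpow A (input S)) C), pi2 _ C⟩)).
Proof.
move=> inj e1 e2 t GI A C f.
pose B := fpow A (state S).
pose Y := fpow B (state I).
pose X := fpow A (state T).
pose r : hom K Y X := ftup (fun t => fprj A (p2 t) ∘ fprj B (p1 t)).
(* Coordinates [(i, s)] that do not come from a state of [T] keep their old value. *)
pose m : hom K (prod X Y) Y := ftup (fun i => ftup (fun s =>
  if [pick t | (p1 t == i) && (p2 t == s)] is Some t then fprj A t ∘ pi1 X Y
  else fprj A s ∘ (fprj B i ∘ pi2 X Y))).
pose f' : hom K (prod (fpow B (input I)) C) B := ftup (fun s =>
  f ∘ ⟨ftup (fun a => fprj A (act s (lS a)) ∘ (fprj B (lI s a) ∘ pi1 _ C)), pi2 _ C⟩).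
have rF : r ∘ dag _ _ (fQ f') = dag _ _ (fQ f).
  apply: (@dag_proj K X Y C r m).
  - apply: fprj_ext => i; apply: fprj_ext => s.
    rewrite compm1 /m fprj_ftup_comp fprj_ftup_comp.
    case: pickP => [t' /andP[/eqP <- /eqP <-]|_]; rewrite !cartE //.
    by rewrite /r fprj_ftup.
  - apply: fprj_ext => t'; rewrite /r fprj_ftup_comp -compA /m !fprj_ftup.
    case: pickP => [t1 /andP[/eqP e3 /eqP e4]|/(_ t')]; last by rewrite !eqxx.
    by rewrite (inj t1 t').
  - apply: fprj_ext => t'; rewrite !fQE /r !fprj_ftup_comp -compA fprj_ftup.
    rewrite /f' fprj_ftup_comp !cartE; congr (f ∘ ⟨_, _⟩).
    apply: fprj_ext => a.
    by rewrite !ftup_comp !fprj_ftup !cartE !fprj_ftup e1 e2 -compA.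
rewrite -rF /r fprj_ftup_comp -compA.
(* The identity at [I], over the object [A^S], replaces the block at [p1 t] by the diagonal
   solution, whose equation is the system of [S]. *)
have -> : fprj B (p1 t) ∘ dag _ _ (fQ f') = _ := GI _ _ f'.
rewrite (@diag_compE (input I)); congr (_ ∘ dag _ _ _).
rewrite fQE /f'; apply: fprj_ext => s.
rewrite fprj_ftup_comp fprj_ftup !cartE; congr (f ∘ ⟨_, _⟩).
by apply: fprj_ext => a; rewrite !ftup_comp !fprj_ftup !cartE !fprj_ftup.
Qed.

Definition unit_automaton (L : finType) : automaton :=
  @Automaton unit L (fun _ _ => tt).

(** The only content is the transport of the dagger along the isomorphism of [fpow A unit] with
    [A]. *)
Lemma Gamma_init_unit (L : finType) : Gamma_init K (tt : state (unit_automaton L)).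
Proof.
move=> A C f; rewrite (@diag_compE L).
apply: (@dag_proj K A (fpow A unit) C (fprj A tt) (ftup (fun _ => pi1 _ _))).
- apply: fprj_ext => -[]; by rewrite fprj_ftup_comp !cartE.
- by rewrite fprj_ftup.
- rewrite fQE fprj_ftup !cartE; congr (f ∘ ⟨_, _⟩).
  by apply: fprj_ext => l; rewrite ftup_comp !fprj_ftup cartE.
Qed.

(** This is [cascade] with a one-state second factor that keeps the letters of [T]. *)
Lemma Gamma_init_sub (T I : automaton) (p : state T -> state I)
    (l : input T -> input I) :
  injective p -> (forall t a, p (act t a) = act (p t) (l a)) ->
  forall t, Gamma_init K (p t) -> Gamma_init K t.
Proof.
move=> inj e t GI A C f.
have := @cascade T I (unit_automaton (input T)) p (fun _ => tt) id (fun _ => l)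
  (fun t t' e1 _ => inj t t' e1) e (fun _ _ => erefl) t GI A C f.
move=> ->.
have -> : forall g, fprj A tt ∘ dag _ _ (fQ (Q := unit_automaton (input T)) g) = _ :=
  @Gamma_init_unit (input T) A C.
congr (dag _ _ (_ ∘ _)); rewrite -[RHS]compm1; congr (_ ∘ _).
rewrite -[RHS]pair_pi; congr ⟨_, _⟩.
by apply: fprj_ext => a; rewrite fprj_ftup.
Qed.

(** By [cascade] the system of [T] reduces to that of [S], whose component at [p2 t] is diagonal. *)
Lemma Gamma_init_prod (T I S : automaton) (p1 : state T -> state I)
    (p2 : state T -> state S) (l1 : input T -> input I) (l2 : input T -> input S) :
  (forall t t', p1 t = p1 t' -> p2 t = p2 t' -> t = t') ->
  (forall t a, p1 (act t a) = act (p1 t) (l1 a)) ->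
  (forall t a, p2 (act t a) = act (p2 t) (l2 a)) ->
  forall t, Gamma_init K (p1 t) -> Gamma_init K (p2 t) -> Gamma_init K t.
Proof.
move=> inj e1 e2 t GI GS A C f.
have -> : fprj A t ∘ dag _ _ (fQ f) = _ :=
  @cascade T I S p1 p2 l2 (fun _ => l1) inj e1 e2 t GI A C f.
have -> : forall g, fprj A (p2 t) ∘ dag _ _ (fQ (Q := S) g) = _ := GS A C.
rewrite (@diag_compE (input S)) (@diag_compE (input T)) !cartE.
congr (dag _ _ (f ∘ ⟨_, _⟩)).
by apply: fprj_ext => a; rewrite ftup_comp !fprj_ftup !cartE fprj_ftup.
Qed.

(** * Reachable states, and nonempty words as letters *)

Definition opt_act Q (q : state Q) (o : option (input Q)) : state Q :=
  if o is Some b then act q b else q.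

(** The letters act as words of length one or two, never as the empty word. *)
Definition pair_automaton Q : automaton :=
  @Automaton (state Q) (input Q * option (input Q))%type
    (fun q p => opt_act (act q p.1) p.2).

(* Over [A^(option Z)] the unknown with index [Some b] at the state [i] stands
   for the unknown of the state [i b]; eliminating these leaves the system of
   [pair_automaton Q]. *)
Lemma Gamma_init_pair Q (q : state Q) (o : option (input Q)) :
  Gamma_init K q -> Gamma_init K (opt_act q o : state (pair_automaton Q)).
Proof.
move=> GQ A C f.
pose L := input Q; pose B := fpow A (option L).
pose Y := fpow B (state Q); pose X := fpow A (state Q).
pose f' : hom K (prod (fpow B L) C) B := ftup (fun o =>
  if o is Some b then fprj A None ∘ (fprj B b ∘ pi1 _ C)
  else f ∘ ⟨ftup (fun p : L * option L => fprj A p.2 ∘ (fprj B p.1 ∘ pi1 _ C)), pi2 _ C⟩).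
have := GQ B C f'; rewrite (@diag_compE L).
have -> : dag _ _ (fQ f')
    = ftup (fun i : state Q => ftup (fun o => fprj A (@opt_act Q i o)))
      ∘ dag _ _ (fQ (Q := pair_automaton Q) f).
  (* [u (x, x')] puts [x] at the index [None] and the shifts of [x'] at the indices [Some b], the
     form required by [dag_elim]. *)
  pose u : hom K (prod X X) Y := ftup (fun i => ftup (fun o =>
    if o is Some b then fprj A (act i b) ∘ pi2 X X else fprj A i ∘ pi1 X X)).
  pose r : hom K Y X := ftup (fun i => fprj A None ∘ fprj B i).
  pose g : hom K (prod Y C) X := ftup (fun i => f ∘ ⟨ftup (fun p : L * option L =>
    fprj A p.2 ∘ (fprj B (act i p.1) ∘ pi1 _ C)), pi2 _ C⟩).
  have ru : r ∘ u = pi1 X X.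
    by apply: fprj_ext => i; rewrite /r fprj_ftup_comp -compA /u !fprj_ftup.
  have -> : fQ f' = u ∘ ⟨g, r ∘ pi1 Y C⟩.
    rewrite fQE; apply: fprj_ext => i; apply: fprj_ext => -[b|];
      rewrite /u !fprj_ftup_comp !fprj_ftup /f' fprj_ftup_comp !cartE fprj_ftup.
      by rewrite /r fprj_ftup_comp -compA.
    congr (f ∘ ⟨_, _⟩); apply: fprj_ext => p.
    by rewrite ftup_comp !fprj_ftup !cartE fprj_ftup.
  rewrite (dag_elim g ru).
  have -> : g ∘ ⟨u ∘ ⟨pi1 X C, pi1 X C⟩, pi2 X C⟩ = fQ (Q := pair_automaton Q) f.
    rewrite fQE; apply: fprj_ext => i.
    rewrite /g fprj_ftup_comp !fprj_ftup !cartE; congr (f ∘ ⟨_, _⟩).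
    apply: fprj_ext => -[a [b|]];
      by rewrite ftup_comp !fprj_ftup !cartE /u fprj_ftup_comp fprj_ftup_comp !cartE.
  apply: fprj_ext => i; apply: fprj_ext => -[b|];
    by rewrite /u !fprj_ftup_comp !cartE.
have -> : f' ∘ ⟨ftup (fun=> pi1 B C), pi2 B C⟩
    = ftup (fun o => if o is Some b then pi2 A A else pi1 A A)
      ∘ ⟨f ∘ ⟨ftup (fun p : L * option L => fprj A p.2 ∘ pi1 B C), pi2 B C⟩,
         fprj A None ∘ pi1 B C⟩.
  apply: fprj_ext => -[b|]; rewrite /f' !fprj_ftup_comp !cartE ?fprj_ftup //.
  congr (f ∘ ⟨_, _⟩); apply: fprj_ext => p.
  by rewrite ftup_comp !fprj_ftup !cartE fprj_ftup.
(* The diagonal equation over [B] has the same shape: its entries at [Some b] copy the entry at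
   [None]. *)
rewrite dag_elim ?fprj_ftup //.
have -> : prj B (enum_rank q) = fprj B q by [].
rewrite fprj_ftup_comp => /(congr1 (comp (fprj A o))).
rewrite !fprj_ftup_comp (@diag_compE (L * option L)%type) => e.
rewrite [LHS]e; case: (o) => [b|]; rewrite cartE;
  congr (dag _ _ _); rewrite !cartE; congr (f ∘ ⟨_, _⟩);
  apply: fprj_ext => -[a [c|]];
  by rewrite ftup_comp !fprj_ftup !cartE fprj_ftup_comp cartE.
Qed.

Lemma Gamma_of_init Q : (forall q : state Q, Gamma_init K q) -> Gamma K Q.
Proof.
move=> GQ A C f; apply: (@fprj_ext K C A (state Q)) => q; rewrite [LHS]GQ compA.
by rewrite /fprj /diag prj_tup comp1m.
Qed.

Lemma Gamma_init_reach Q (q : state Q) w :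
  Gamma_init K q -> Gamma_init K (act_word q w).
Proof.
elim: w q => [//|b w IH] q GQ; apply: IH.
(* The letters [(a, None)] recover [Q] inside [pair_automaton Q]. *)
apply: (@Gamma_init_sub Q (pair_automaton Q) id (fun a => (a, None))) => //.
exact: (Gamma_init_pair (Some b)).
Qed.

(** Each passage to the pair automaton allows one more letter; the length bound keeps the alphabet
    finite. *)
Lemma Gamma_init_short_words Q n : (forall q : state Q, Gamma_init K q) ->
  exists (L : finType) (a : state Q -> L -> state Q),
    (forall q, Gamma_init K (q : state (Automaton a))) /\
    (forall w : seq (input Q), 0 < size w <= n.+1 ->
      exists l, forall q, a q l = act_word q w).
Proof.
move=> GQ; elim: n => [|n [L [a [GL aw]]]].
  exists (input Q), (@act Q); split=> [q|[//|b [|//]] _]; last by exists b.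
  exact: (@Gamma_init_sub (Automaton (@act Q)) Q id id).
exists (L * option L)%type, (@act (pair_automaton (Automaton a))); split=> [q|w].
  exact: (Gamma_init_pair (Q := Automaton a) None).
case/lastP: w => [//|v b]; rewrite size_rcons /= ltnS => sv.
have [lb elb] := aw [:: b] erefl.
(* The induction hypothesis covers nonempty words only, so a single letter is treated apart. *)
case: (posnP (size v)) => [/size0nil ->|v0]; first by exists (lb, None).
have [|lv elv] := aw v; first by rewrite v0.
by exists (lv, Some lb) => q; rewrite /= elv elb /act_word -cats1 foldl_cat.
Qed.

Lemma Gamma_init_words Q (J : finType) (h : state Q -> J -> state Q) :
  (forall q : state Q, Gamma_init K q) ->
  (forall j, exists2 w, 0 < size w & forall q, h q j = act_word q w) ->
  forall q, Gamma_init K (q : state (Automaton h)).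
Proof.
move=> GQ hw q.
have /fin_all_exists[w ew] :
  forall j, exists w, 0 < size w /\ forall q, h q j = act_word q w.
  by move=> j; have [w w0 ew] := hw j; exists w.
have [L [a [GL aw]]] := Gamma_init_short_words (\max_j size (w j)) GQ.
have /fin_all_exists[l hl] : forall j, exists l, forall q, h q j = a q l.
  move=> j; have [w0 hj] := ew j; have [|l el] := aw (w j).
    by rewrite w0 leqW // (@leq_bigmax J (fun j => size (w j))).
  by exists l => q'; rewrite hj el.
exact: (@Gamma_init_sub (Automaton h) (Automaton a) id l).
Qed.

(** * Powers and quotients *)

Definition tuple_automaton Q n : automaton :=
  @Automaton (n.-tuple (state Q)) (input Q)
    (fun t a => map_tuple (fun q => act q a) t).

Lemma Gamma_init_tuple Q n : (forall q : state Q, Gamma_init K q) ->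
  forall t : state (tuple_automaton Q n), Gamma_init K t.
Proof.
move=> GQ; elim: n => [|n IH] t.
  apply: (@Gamma_init_sub (tuple_automaton Q 0) (unit_automaton (input Q)) (fun _ => tt) id) => //.
    by move=> t1 t2 _; rewrite (tuple0 t1) (tuple0 t2).
  exact: Gamma_init_unit.
pose p2 (t : n.+1.-tuple (state Q)) : n.-tuple (state Q) := behead_tuple t.
apply: (@Gamma_init_prod (tuple_automaton Q n.+1) Q (tuple_automaton Q n)
  (@thead n (state Q)) p2 id id) => //.
- move=> t1 t2; rewrite (tuple_eta t1) (tuple_eta t2) !theadE => -> /(congr1 val) /= e.
  by apply: val_inj => /=; rewrite e.
- by move=> t1 a; rewrite (tuple_eta t1) /= !theadE.
- by move=> t1 a; apply: val_inj; rewrite /= behead_map.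
Qed.

(* With a section [s] of [phi], [h |-> (h (s (phi h))^-1, phi h)] embeds the
   regular automaton of [J] into a cascade of itself under that of [gT]; so the
   system over [J] reduces both to the one over [gT] and to the diagonal one. *)
Lemma Gamma_init_quotient (J : finType) (op : J -> J -> J) (inv : J -> J)
    (gT : finGroupType) (phi : J -> gT) :
  associative op -> (forall x y, op (op x (inv y)) y = x) ->
  {morph phi : x y / op x y >-> (x * y)%g} -> (forall g, exists x, phi x = g) ->
  (forall x, Gamma_init K (x : state (Automaton op))) ->
  forall g, Gamma_init K (g : state (group_automaton gT)).
Proof.
move=> opA opK phiM /fin_all_exists[s sK] GJ g A C f.
pose R := Automaton op.
(* The regular automaton of [J], with its letters restricted to the section [s]. *)
pose T := Automaton (fun h (l : gT) => op h (s l)).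
have GT : Gamma_init K (s g : state T) by apply: (@Gamma_init_sub T R id s).
rewrite -GT.
have := @cascade T R (group_automaton gT) (fun h => op h (inv (s (phi h)))) phi id
  (* The cocycle [s g * s l * (s (g * l))^-1] takes [h (s (phi h))^-1] to the corresponding element
     for [h * s l]. *)
  (fun g l => op (s g) (op (s l) (inv (s (g * l)%g)))).
move=> /(_ _ _ _ (s g) (GJ _) A C f) ->.
- rewrite sK; congr (_ ∘ dag _ _ (fQ _)).
  rewrite -[LHS]compm1; congr (_ ∘ _).
  rewrite -[LHS]pair_pi; congr ⟨_, _⟩.
  by apply: fprj_ext => a; rewrite fprj_ftup.
- by move=> h h' /= e1 e2; rewrite -(opK h (s (phi h))) e1 e2 opK.
- by move=> h l /=; rewrite phiM sK !opA opK.
- by move=> h l /=; rewrite phiM sK.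
Qed.

End Automata.

(** * From the transition monoid to its simple divisors *)

Theorem theorem3p4 (K : conwayCat) (Q : automaton) (q : state Q) :
  0 < #|input Q| ->
  initially_connected q ->
  Gamma_init K q ->
  forall gT : finGroupType,
    simple [set: gT] -> divides_monoid gT Q -> Gamma K (group_automaton gT).
Proof.
move=> _ conn Gq gT simG [H [[Hw [HM [e He [eH invH]]]] [phi [phiM phiH]]]].
have GQ (p : state Q) : Gamma_init K p.
  by have [w ->] := conn p; apply: Gamma_init_reach.
have surj g : exists2 h, h \in H & phi h = g.
  by have /imsetP[h Hh ->] : g \in phi @: H; [rewrite phiH inE | exists h].
have [h1 Hh1 ph1] : exists2 h, h \in H & phi h != 1%g.
  have /trivgPn[g _ g1] : [set: gT] != 1%g by case/simpleP: simG.
  by have [h Hh hg] := surj g; exists h => //; rewrite hg.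
have nonempty_word h : h \in H ->
    exists2 w, 0 < size w & forall p, h p = act_word p w.
  (* [h1] is not induced by the empty word, and [h = h1 (h1^-1 h)]. *)
  move=> Hh; have [h2 Hh2 [h12 _]] := invH _ Hh1.
  have [w1 ew1] := Hw _ Hh1; have [w ew] := Hw _ (HM _ _ Hh2 Hh).
  exists (w1 ++ w) => [|p].
    (* Were [w1] empty, [h1] would be idempotent and [phi h1] trivial. *)
    rewrite size_cat addn_gt0 lt0n; apply/orP; left; apply: contra ph1 => /nilP w10.
    have hh : mmul h1 h1 = h1 by apply/ffunP => p; rewrite ffunE !ew1 w10.
    by have := phiM _ _ Hh1 Hh1; rewrite hh -{1}[phi h1]mulg1 => /mulgI <-.
  rewrite /act_word foldl_cat -/(act_word p w1) -ew1 -/(act_word _ w) -ew ffunE.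
  by have [eh _] := eH _ Hh; rewrite -{1}eh -h12 !ffunE.
pose J : finType := {h : {ffun state Q -> state Q} | h \in H}.
pose op (x y : J) : J := Sub (mmul (val x) (val y)) (HM _ _ (valP x) (valP y)).
have /fin_all_exists[inv invP] : forall x : J, exists y : J, mmul (val y) (val x) = e.
  by move=> x; have [y Hy [_ xy]] := invH _ (valP x); exists (Sub y Hy).
pose QH := Automaton (fun p (x : J) => val x p).
have GH (p : state QH) : Gamma_init K p.
  by apply: Gamma_init_words => // x; apply: nonempty_word (valP x).
apply: Gamma_of_init => g.
apply: (@Gamma_init_quotient K J op inv gT (fun x => phi (val x))).
- by move=> x y z; apply: val_inj; apply/ffunP => p; rewrite !ffunE.
- move=> x y; apply: val_inj; rewrite -[RHS](proj2 (eH _ (valP x))) -(invP y).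
  by apply/ffunP => p; rewrite !ffunE.
- by move=> x y; apply: phiM; apply: valP.
- by move=> g'; have [h Hh <-] := surj g'; exists (Sub h Hh).
(* A transformation is determined by its table of values, and multiplying by [z] on the right
   applies [z] to each entry. *)
move=> x; pose p (x : J) := map_tuple (val x) (enum_tuple (state Q)).
apply: (@Gamma_init_sub K (Automaton op) (tuple_automaton QH _) p id) => //.
- move=> y z /(congr1 val) /eq_in_map yz; apply: val_inj; apply/ffunP => r.
  by apply: yz; rewrite mem_enum.
- move=> y z; apply: val_inj => /=; rewrite -map_comp.
  by apply: eq_map => r; rewrite /= ffunE.
- exact: Gamma_init_tuple.
Qed.
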